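(* Let $G$ be a graph with at least $7$ vertices. Then $F(G)\geq 3$.
   Context: All graphs are finite and simple. Given a graph $G$ and a set $S\subseteq V(G)$ of vertices (called blue; the others are white), the forcing rule is: if a vertex $v\in S$ has exactly one neighbor $u$ not in $S$, then $u$ is added to $S$. A set $S$ is a failed zero-forcing set of $G$ if repeated application of the forcing rule starting from $S$ does not result in all vertices of $G$ being in $S$. The failed zero-forcing number $F(G)$ is the maximum cardinality of a failed zero-forcing set of $G$ (the empty set counts as a set of cardinality $0$). *)

(* Defs.v *)
From mathcomp Require Import all_boot.

Set Implicit Arguments.
Unset Strict Implicit.
Unset Printing Implicit Defensive.

Definition simple_graph (V : finType) (e : rel V) : Prop :=
  symmetric e /\ irreflexive e.

Section FailedZeroForcing.

Variables (V : finType) (e : rel V).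
Implicit Types S : {set V}.

Definition neighbors (v : V) : {set V} := [set u | e v u].

Definition can_force S (v u : V) : bool :=
  (v \in S) && (neighbors v :\: S == [set u]).

Definition force_step : rel {set V} := fun S S' =>
  [exists v, exists u, can_force S v u && (S' == u |: S)].

(* The order of the forces is left free. It does not matter: an available
   force v -> u remains available until u is blue, so every maximal sequence
   of forces from S ends in the same set. *)
Definition zero_forcing S : bool := connect force_step S [set: V].

Definition failed_zero_forcing S : bool := ~~ zero_forcing S.

(* The maximum is over a nonempty family as soon as V is nonempty, because
   set0 is then failed. *)
Definition failed_zero_forcing_number : nat :=
  \max_(S : {set V} | failed_zero_forcing S) #|S|.

End FailedZeroForcing.

(* Main.v *)
Require Import Defs.
From mathcomp Require Import all_boot.

(** The complement of a stalled set is a fort: a nonempty set [W] such that no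
    vertex outside [W] has exactly one neighbour in [W]. So it suffices to find
    a fort missing at least three vertices. Call a graph without such a fort
    tight. In a tight graph every three vertices include one of degree at most
    3 (otherwise these three form a stalled set), so there is a vertex [v] of
    degree at most 3. Delete [v] and complement the adjacency between its
    neighbours: if [W] is a fort of the resulting graph, then [W] or [v |: W] is
    a fort of the original one, hence the new graph is tight again. Reversing
    this reduction generates all tight graphs from the empty graph, and a finite
    enumeration shows that none has 7 vertices. Since the reduction lowers the
    number of vertices by one, none has more than 7 either. *)

Set Implicit Arguments.
Unset Strict Implicit.
Unset Printing Implicit Defensive.

(** * Forts and tight graphs *)

Section Forts.

Variable V : finType.
Implicit Types (e : rel V) (A W : {set V}) (s : seq V) (v : V).

Definition nbrs_in e W v : {set V} := [set y in W | e v y].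

Definition fort e A W : Prop :=
  [/\ W != set0, W \subset A
    & {in A :\: W, forall u, #|nbrs_in e W u| != 1}].

Definition tight e A : Prop :=
  forall W, fort e A W -> #|A| < #|W| + 3.

(** The blue set stays disjoint from [W]: while all of [W] is white, a force into [W] would come
    from a vertex outside [W] with exactly one neighbour in [W]. *)
Lemma fort_compl_failed e W :
  fort e [set: V] W -> failed_zero_forcing e (~: W).
Proof.
case=> /set0Pn[w wW] _ fW; apply/negP => /connectP[p].
have: [disjoint ~: W & W] by rewrite disjoints_subset.
elim: p (~: W) => [|S' p IHp] S dSW /= => [_ /setP/(_ w)|].
  by rewrite inE (disjointFl dSW wW).
case/andP=> /existsP[v /existsP[u /andP[/andP[vS /eqP nvS] /eqP->]]].
apply: IHp; rewrite disjoints_subset subUset sub1set inE.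
rewrite -(disjoints_subset S) dSW andbT.
apply/negP => uW; have vW: v \in [set: V] :\: W.
  by rewrite !inE andbT (disjointFr dSW vS).
case/negP: (fW v vW); apply/eqP; rewrite -(cards1 u) -nvS; apply: eq_card => y.
rewrite /neighbors !inE; case: (boolP (y \in W)) => [yW | yNW].
  by rewrite (disjointFl dSW yW).
move/setP/(_ y): nvS; rewrite /neighbors !inE => ->.
by apply/esym/eqP => yu; rewrite yu uW in yNW.
Qed.

Lemma tight_small_degree e A : A != set0 -> tight e A ->
  exists2 v, v \in A & #|nbrs_in e (A :\ v) v| <= 3.
Proof.
move=> /set0Pn[a aA] tA.
case: (boolP [exists v in A, #|nbrs_in e (A :\ v) v| <= 3]) => [/exists_inP[v]|].
  by exists v.
rewrite negb_exists_in => /forall_inP big.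
have deg v : v \in A -> 4 <= #|nbrs_in e (A :\ v) v|.
  by move/big; rewrite -ltnNge.
have A5: 5 <= #|A|.
  rewrite (cardsD1 a) aA; apply: leq_trans (deg a aA) _.
  by apply: subset_leq_card; apply/subsetP => y; rewrite inE => /andP[].
have: 3 <= #|A| by apply: leq_trans A5.
case/card_geqP => s [us ss sA].
pose S := [set x in s].
have SA: S \subset A by apply/subsetP => x; rewrite inE => /sA.
have cS: #|S| = 3 by rewrite cardsE (card_uniqP us).
have cW: #|A :\: S| = #|A| - 3 by rewrite cardsDS // cS.
suff /tA: fort e A (A :\: S) by rewrite cW subnK ?ltnn // (leq_trans _ A5).
split; first by rewrite -card_gt0 cW subn_gt0 (leq_trans _ A5).
  exact: subsetDl.
move=> u; rewrite !inE negb_and negbK.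
case: (boolP (u \in A)) => uA; last by rewrite andbF.
rewrite orbF andbT => us'.
have uS : u \in S by rewrite inE.
(* At most two of the four or more neighbours of [u] lie in [S], so at least two lie in
   [A :\: S]. *)
have sub: nbrs_in e (A :\ u) u \subset nbrs_in e (A :\: S) u :|: (S :\ u).
  apply/subsetP => y; rewrite !inE => /andP[/andP[-> ->] ->].
  by case: (y \in s).
have := leq_trans (deg u uA) (leq_trans (subset_leq_card sub) (leq_card_setU _ _)).
have := cardsD1 u S; rewrite uS cS => -[]; rewrite add0n => <- h.
by rewrite neq_ltn; apply/orP; right; rewrite -(leq_add2r 2).
Qed.

(** Local complementation at [v]. It also flips loops at neighbours of [v]; this is harmless, since
    forts only test edges between [W] and its complement. *)
Definition toggle e v : rel V := fun x y => e x y (+) (e v x && e v y).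

Lemma toggle_sym e v : symmetric e -> symmetric (toggle e v).
Proof. by move=> se x y; rewrite /toggle se andbC. Qed.

(** If neither [W] nor [v |: W] were a fort of [e], then [v] would have two neighbours inside [W]
    and two outside, against the degree bound. *)
Lemma tight_toggle e A v : symmetric e -> v \in A ->
  #|nbrs_in e (A :\ v) v| <= 3 -> tight e A -> tight (toggle e v) (A :\ v).
Proof.
move=> se vA dv tA W [W0 WA fW].
have vW: v \notin W.
  by apply/negP => /(subsetP WA); rewrite !inE eqxx.
have WsA: W \subset A by apply: subset_trans WA (subsetDl _ _).
have fW' u : u \in A -> u \notin W -> u != v -> #|nbrs_in (toggle e v) W u| != 1.
  by move=> uA uW uv; apply: fW; rewrite !inE uW uv.
have toggleN u : ~~ e v u -> nbrs_in (toggle e v) W u = nbrs_in e W u.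
  by move=> /negbTE vu; apply/setP => y; rewrite !inE /toggle vu addbF.
have toggle0 u : e v u -> #|nbrs_in e W u| = 0 ->
    nbrs_in (toggle e v) W u = nbrs_in e W v.
  move=> vu /eqP; rewrite cards_eq0 => /eqP/setP nu.
  apply/setP => y; have := nu y; rewrite !inE /toggle vu.
  by case: (y \in W) => //= ->.
have cA := cardsD1 v A; rewrite vA in cA.
(* Besides [v] itself, only vertices of [U] can prevent [W] from being a fort of [e] in [A]. *)
pose U := [set u in (A :\ v) :\: W | e v u && (#|nbrs_in e W u| == 1)].
have [/andP[k1 /eqP U0] | ] := boolP ((#|nbrs_in e W v| != 1) && (U == set0)).
  have /tA: fort e A W.
    split=> // u; rewrite inE => /andP[uW uA].
    have [-> // | uv] := eqVneq u v.
    case: (boolP (e v u)) => vu; last by rewrite -toggleN // fW'.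
    apply/negP => c1; move/setP/(_ u): U0.
    by rewrite !inE uW uv uA vu c1.
  by rewrite cA; apply: leq_trans.
move=> kU.
have /tA: fort e A (v |: W).
  split; first by apply/set0Pn; exists v; rewrite setU11.
    by rewrite subUset sub1set vA.
  move=> u; rewrite !inE negb_or => /andP[/andP[uv uW] uA].
  case: (boolP (e v u)) => vu; last first.
    have -> : nbrs_in e (v |: W) u = nbrs_in e W u.
      apply/setP => y; rewrite !inE.
      by have [->|//] := eqVneq y v; rewrite se (negbTE vu) !andbF.
    by rewrite -toggleN // fW'.
  have -> : nbrs_in e (v |: W) u = v |: nbrs_in e W u.
    apply/setP => y; rewrite !inE.
    by have [->|] := eqVneq y v; rewrite // se vu.
  (* Suppose [v |: W] fails at [u]: then [u] sees nothing of [W], and after toggling it sees there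
     exactly what [v] sees. So [v] does not fail for [W], and [U] must be nonempty. *)
  rewrite cardsU1 inE (negbTE vW) /= eqSS; apply/eqP => c0.
  have k1: #|nbrs_in e W v| != 1 by rewrite -(toggle0 u) // fW'.
  move: kU; rewrite k1 /= => /set0Pn[u0].
  rewrite !inE => /andP[/and3P[u0W u0v u0A] /andP[vu0 /eqP c1]].
  have u0u : u0 != u by apply: contra_eq_neq c1 => ->; rewrite c0.
  (* Otherwise toggling would leave [u0] with its single neighbour in [W]. *)
  have k0: #|nbrs_in e W v| != 0.
    apply/negP; rewrite cards_eq0 => /eqP/setP k0.
    case/negP: (fW' _ u0A u0W u0v); rewrite -c1; apply/eqP/eq_card => y.
    have := k0 y; rewrite !inE /toggle vu0 /=.
    by case: (y \in W) => //= ->; rewrite addbF.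
  have k2: 2 <= #|nbrs_in e W v| by case: #|_| k0 k1 => [|[]].
  have: nbrs_in e W v :|: [set u0; u] \subset nbrs_in e (A :\ v) v.
    apply/subsetP => y; rewrite !inE => /or3P[/andP[yW ->] | /eqP-> | /eqP->].
    - by move/(subsetP WA): yW; rewrite !inE => ->.
    - by rewrite u0v u0A.
    - by rewrite uv uA.
  move/subset_leq_card; rewrite cardsU cards2 u0u.
  rewrite (_ : _ :&: _ = set0) ?cards0 ?subn0; last first.
    apply/setP => y; rewrite !inE.
    have [->|_] := eqVneq y u0; first by rewrite (negbTE u0W).
    by have [->|_] := eqVneq y u; rewrite ?(negbTE uW) // andbF.
  by move/leq_trans/(_ dv); rewrite addn2 ltnS ltnS leqNgt k2.
by rewrite cA cardsU1 vW -addnA ltn_add2l.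
Qed.

End Forts.

(** * Encoding of graphs and forts by bit sequences *)

(* A graph on a list of vertices is encoded by the strict upper triangle of its
   adjacency matrix, so that loops are ignored. *)
Fixpoint triangle (V : Type) (e : rel V) (s : seq V) : seq bitseq :=
  if s is x :: s' then [seq e x y | y <- s'] :: triangle e s' else [::].

(** [N] is the adjacency row of the deleted vertex. Toggling is an involution, so the same operation
    rebuilds the original graph. *)
Fixpoint toggle_triangle (N : bitseq) (m : seq bitseq) : seq bitseq :=
  match N, m with
  | b :: N', r :: m' =>
      (if b then [seq p.1 (+) p.2 | p <- zip N' r] else r)
        :: toggle_triangle N' m'
  | _, _ => [::]
  end.

Lemma toggle_triangleE (V : finType) (e : rel V) v s :
  toggle_triangle [seq e v y | y <- s] (triangle (toggle e v) s) = triangle e s.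
Proof.
elim: s => //= x s ->; congr (_ :: _).
case vx: (e v x); last by apply: eq_map => y; rewrite /toggle vx addbF.
rewrite zip_map -map_comp; apply: eq_map => y /=.
by rewrite /toggle vx /= addbC addbK.
Qed.

Fixpoint degrees_in (W : bitseq) (m : seq bitseq) : seq nat :=
  match W, m with
  | w :: W', r :: m' =>
      count id (mask W' r)
        :: [seq (w && p.1) + p.2 | p <- zip r (degrees_in W' m')]
  | _, _ => [::]
  end.

Lemma degrees_inE (V : finType) (e : rel V) (W : {set V}) s :
  symmetric e -> uniq s ->
  degrees_in [seq x \in W | x <- s] (triangle e s)
    = [seq count (fun y => [&& y != x, y \in W & e x y]) s | x <- s].
Proof.
move=> se; elim: s => //= x s IHs /andP[xs us]; rewrite eqxx /= add0n.
congr (_ :: _).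
  rewrite -map_mask count_map -filter_mask count_filter.
  apply: eq_in_count => y ys /=; rewrite andbC.
  by rewrite (_ : y != x) //; apply: contraNneq xs => <-.
rewrite IHs // zip_map -map_comp; apply/eq_in_map => y ys /=; rewrite se.
by rewrite (_ : x != y) //; apply: contraNneq xs => ->.
Qed.

Definition fortb (m : seq bitseq) (W : bitseq) : bool :=
  all (fun p => p.1 || (p.2 != 1)) (zip W (degrees_in W m)).

Lemma map_in_mask (T : eqType) (s : seq T) (W : bitseq) :
  uniq s -> size W = size s -> [seq x \in mask W s | x <- s] = W.
Proof.
elim: s W => [|x s IHs] [|w W] //= /andP[xs us] [sW]; congr (_ :: _).
  case: w; rewrite ?mem_head //.
  by apply/negbTE; apply: contra xs => /mem_mask.
rewrite -[RHS]IHs //; apply/eq_in_map => y ys; case: w => //.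
by rewrite inE; have [yx|//] := eqVneq y x; rewrite -yx ys in xs.
Qed.

Lemma fortb_fort (V : finType) (e : rel V) (s : seq V) (W : bitseq) :
  symmetric e -> uniq s -> size W = size s -> has id W ->
  fortb (triangle e s) W ->
  fort e [set x in s] [set x in mask W s] /\ #|[set x in mask W s]| = count id W.
Proof.
move=> se us sW W0 fW; set X := [set x in mask W s].
have cX: #|X| = count id W.
  by rewrite cardsE (card_uniqP (mask_uniq us W)) size_mask.
have EW: W = [seq x \in X | x <- s].
  by rewrite -[LHS](map_in_mask us sW); apply: eq_map => x; rewrite inE.
split=> //; split.
- by rewrite -card_gt0 cX -has_count.
- by apply/subsetP => x; rewrite !inE => /mem_mask.
move=> u; rewrite in_setD [u \in [set _ in s]]inE => /andP[uX us'].
move: fW; rewrite /fortb EW degrees_inE // zip_map all_map => /allP/(_ u us') /=.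
rewrite (negbTE uX) /=; congr (_ != 1).
rewrite -size_filter -(card_uniqP (filter_uniq _ us)); apply: eq_card => y.
rewrite mem_filter [RHS]inE; case: (boolP (y \in X)) => yX; last by rewrite andbF.
have -> : y != u by apply: contraNneq uX => <-.
by rewrite /= andbC; move: yX; rewrite inE => /mem_mask->.
Qed.

(** * Enumeration of the tight graphs *)

Fixpoint bitseqs n : seq bitseq :=
  if n is n'.+1
  then [seq false :: b | b <- bitseqs n'] ++ [seq true :: b | b <- bitseqs n']
  else [:: [::]].

Lemma mem_bitseqs n (b : bitseq) : (b \in bitseqs n) = (size b == n).
Proof.
have cons_inj c : injective (cons c : bitseq -> bitseq) by move=> x y [].
have Ncons c d (r : bitseq) l : c != d -> (c :: r \in [seq d :: x | x <- l]) = false.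
  by move=> cd; apply/negP => /mapP[x _ [ecd _]]; rewrite ecd eqxx in cd.
elim: n b => [|n IHn] [|c b] //=.
  by rewrite mem_cat; apply/negP => /orP[] /mapP[].
rewrite mem_cat eqSS -IHn.
case: c; first by rewrite (Ncons true false) // (mem_map (cons_inj true)).
by rewrite (Ncons false true) // orbF (mem_map (cons_inj false)).
Qed.

(** Only candidates, by size; [fortb] tests them against a given graph. *)
Definition small_forts n : seq bitseq :=
  [seq W <- bitseqs n | has id W && (count id W + 3 <= n)].

(* The triangles of tight graphs on [n] vertices, up to isomorphism and with
   repetitions. *)
Fixpoint tight_triangles n : seq (seq bitseq) :=
  if n is n'.+1 then
    let Ns := [seq N <- bitseqs n' | count id N <= 3] in
    let Ws := small_forts n in
    [seq m <- [seq N :: toggle_triangle N m | m <- tight_triangles n', N <- Ns]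
       | ~~ has (fortb m) Ws]
  else [:: [::]].

Lemma tight_triangles_complete (V : finType) (e : rel V) (A : {set V}) :
  symmetric e -> tight e A ->
  exists s, [/\ uniq s, A = [set x in s] & triangle e s \in tight_triangles #|A|].
Proof.
(* The relation [e] is generalized because the induction hypothesis is applied to the toggled
   graph. *)
have [n] := ubnP #|A|; elim: n e A => // n IHn e A ltAn se tA.
have [-> | A0] := eqVneq A set0.
  by exists [::]; rewrite cards0; split=> //; apply/setP => x; rewrite !inE.
have [v vA dv] := tight_small_degree A0 tA.
have cA := cardsD1 v A; rewrite vA in cA.
have [] := IHn (toggle e v) (A :\ v) _ (toggle_sym v se) (tight_toggle se vA dv tA).
  by rewrite cA in ltAn.
move=> s [us As ms].
have vs: v \notin s by move/setP/(_ v): As; rewrite !inE eqxx => <-.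
have uvs: uniq (v :: s) by rewrite /= vs.
have Avs: A = [set x in v :: s].
  by rewrite -(setD1K vA) As; apply/setP => x; rewrite !inE.
have szs: size s = #|A :\ v| by rewrite As cardsE (card_uniqP us).
(* Each deleted vertex goes in front, so that its row heads the triangle as in the enumeration. *)
exists (v :: s); split=> //; rewrite cA add1n [tight_triangles _]/= mem_filter.
apply/andP; split.
  apply/hasPn => W; rewrite /small_forts mem_filter mem_bitseqs.
  case/andP=> /andP[W0 cW] /eqP sW; apply/negP => fW.
  have [|fA cX] := fortb_fort se uvs _ W0 fW; first by rewrite /= szs.
  by rewrite -Avs in fA; have := tA _ fA; rewrite cX cA add1n ltnNge cW.
apply/allpairsP; exists (triangle (toggle e v) s, [seq e v y | y <- s]); split=> //=.
  rewrite mem_filter mem_bitseqs size_map szs eqxx andbT.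
  apply: leq_trans dv; rewrite count_map -size_filter.
  rewrite -(card_uniqP (filter_uniq _ us)) subset_leq_card //.
  by apply/subsetP => x; rewrite mem_filter /nbrs_in As !inE andbC.
by rewrite toggle_triangleE.
Qed.

Lemma tight_triangles7 : tight_triangles 7 = [::].
Proof. by vm_compute. Qed.

Lemma tight_triangles_ge7 n : 7 <= n -> tight_triangles n = [::].
Proof.
elim: n => // n IHn; rewrite leq_eqVlt => /predU1P[<- | lt7n].
  exact: tight_triangles7.
by rewrite [LHS]/= IHn.
Qed.

Theorem theorem2p1 (V : finType) (e : rel V) (He : simple_graph e)
    (HV : 7 <= #|V|) :
  3 <= failed_zero_forcing_number e.
Proof.
case: He => se _; rewrite leqNgt; apply/negP => F2.
have tV: tight e [set: V].
  move=> W fW; rewrite ltnNge; apply/negP; rewrite cardsT => cW.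
  (* The complement of a fort missing three vertices is a failed set of size at least 3. *)
  move: F2; rewrite ltnNge => /negP; apply.
  apply: leq_trans (leq_bigmax_cond _ (fort_compl_failed fW)).
  by rewrite -(leq_add2l #|W|) cardsC.
have [s [_ _]] := tight_triangles_complete se tV.
by rewrite cardsT tight_triangles_ge7.
Qed.
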